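(* Let $G=\pi_1(X_K,x_0)$ be the group of a nontrivial tame knot $K\subset S^3$ with meridian $m\in G$, let $U\le G$ be a finite-index subgroup and let $M_U\trianglelefteq U$ be its ramification subgroup. Let $q:U\twoheadrightarrow F$ be a surjective homomorphism onto a finite group $F$. Then $q(M_U)$ is normal in $F$ and is the normal closure in $F$ of the union of the images $q(I_g(U))$, $g\in G$: $$q(M_U)=\left\langle\!\left\langle q(I_g(U))\ :\ g\in G\right\rangle\!\right\rangle_F .$$ Equivalently, $F/q(M_U)$ is the largest quotient of $F$ in which the images of all $I_g(U)$ are trivial; that is, the image of every $q(I_g(U))$ in $F/q(M_U)$ is trivial, and every normal subgroup $N\trianglelefteq F$ such that the image of $q(I_g(U))$ in $F/N$ is trivial for all $g\in G$ satisfies $q(M_U)\subseteq N$.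
   Context: $K\subset S^3$ is a nontrivial tame knot, $\nu(K)$ is a tubular neighbourhood of $K$, $X_K=S^3\setminus\operatorname{int}(\nu(K))$ is the knot exterior, $x_0\in\partial X_K$ is a basepoint, and $G=\pi_1(X_K,x_0)$. A meridian is an element of $\pi_1(\partial X_K,x_0)$ represented by a simple closed curve on the torus $\partial X_K$ bounding an embedded disk in $\nu(K)$ that meets $K$ once; $m\in G$ denotes the image of a chosen meridian under the map induced by inclusion $\partial X_K\hookrightarrow X_K$. For a finite-index subgroup $U\le G$ and $g\in G$, the meridional inertia subgroup is $I_g(U):=U\cap g\langle m\rangle g^{-1}$. The ramification subgroup $M_U$ of $U$ is the normal closure in $U$ of $\bigcup_{g\in G}I_g(U)$, i.e. the smallest normal subgroup of $U$ containing every $I_g(U)$, $g\in G$. The notation $\langle\!\langle S_g : g\in G\rangle\!\rangle_F$ denotes the normal closure in $F$ of $\bigcup_g S_g$. *)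

(* Defs.v *)
From HB Require Import structures.
From mathcomp Require Import all_boot all_order all_fingroup all_algebra.
From mathcomp Require Import generic_quotient ring lra.
From mathcomp Require Import all_classical all_reals all_analysis.
Set Implicit Arguments.
Unset Strict Implicit.
Unset Printing Implicit Defensive.
Import Order.TTheory GRing.Theory Num.Theory numFieldNormedType.Exports.
Local Open Scope classical_set_scope.
Local Open Scope quotient_scope.
Local Open Scope ring_scope.

Section Within.

Lemma within_comp (U V W : topologicalType) (A : set U) (B : set V)
    (f : U -> V) (g : V -> W) :
  {within A, continuous f} -> (forall x, A x -> B (f x)) ->
  {within B, continuous g} -> {within A, continuous (g \o f)}.
Proof.
move=> cf AB cg; rewrite continuous_subspace_in => x /set_mem Ax P Pgfx.
have := cg (f x) P Pgfx; rewrite /nbhs /= -nbhs_subspace_in; last exact: AB.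
move=> Q1; have := cf x _ Q1; rewrite /nbhs /= -nbhs_subspace_in //.
move=> Q2; apply: (@filterS _ (nbhs x)) Q2 => z /= BP Az.
exact: BP Az (AB _ Az).
Qed.

Lemma within_eq (U V : topologicalType) (A : set U) (f g : U -> V) :
  (forall x, A x -> f x = g x) ->
  {within A, continuous f} -> {within A, continuous g}.
Proof. by move=> fg; apply: subspace_eq_continuous => x /set_mem /fg. Qed.

Lemma within_paste (U V : topologicalType) (A B C : set U) (f g h : U -> V) :
  closed A -> closed B -> C `<=` A `|` B ->
  (forall x, A x -> f x = h x) -> (forall x, B x -> g x = h x) ->
  {within A, continuous f} -> {within B, continuous g} ->
  {within C, continuous h}.
Proof.
move=> cA cB CAB fh gh cf cg; apply: (continuous_subspaceW CAB).
by apply: withinU_continuous => //; [exact: within_eq cf|exact: within_eq cg].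
Qed.

End Within.

Section Pi1.
Context {R : realType}.
Local Notation I := (`[0%R, 1%R]%classic : set R).
Local Notation II := (I `*` I).

Lemma closed_le (U : topologicalType) (f g : U -> R) :
  continuous f -> continuous g -> closed [set x | f x <= g x].
Proof.
move=> cf cg.
have -> : [set x | f x <= g x] = (fun x => g x - f x) @^-1` [set y | 0 <= y].
  by apply/seteqP; split => x /=; rewrite subr_ge0.
apply: preimage_closed; last exact: closed_ge.
by move=> x _; apply: continuousB; [exact: cg|exact: cf].
Qed.

Lemma ctsB (U : topologicalType) (a b : U -> R) :
  continuous a -> continuous b -> continuous (fun t => a t - b t).
Proof.
by move=> ca cb t; apply: (@continuousB R R^o U a b); [exact: ca|exact: cb].
Qed.

Lemma ctsM (U : topologicalType) (a b : U -> R) :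
  continuous a -> continuous b -> continuous (fun t => a t * b t).
Proof.
by move=> ca cb t; apply: (@continuousM R U a b); [exact: ca|exact: cb].
Qed.

Lemma ctsC (U : topologicalType) (c : R) : continuous (fun _ : U => c).
Proof. by move=> t; exact: cst_continuous. Qed.

Lemma cts1 : continuous (fun p : R * R => p.1).
Proof. by move=> p; exact: cvg_fst. Qed.

Lemma cts2 : continuous (fun p : R * R => p.2).
Proof. by move=> p; exact: cvg_snd. Qed.

Lemma ctsI : continuous (fun t : R => t).
Proof. by move=> t; exact: cvg_id. Qed.

Lemma cts_pair (U V W : topologicalType) (a : U -> V) (b : U -> W) :
  continuous a -> continuous b -> continuous (fun t => (a t, b t)).
Proof. by move=> ca cb t; apply: cvg_pair; [exact: ca|exact: cb]. Qed.

Local Ltac cts_tac :=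
  do ?[exact: cts1|exact: cts2|exact: ctsI|exact: ctsC
      |apply: cts_pair|apply: ctsB|apply: ctsM].

Lemma closed_II : closed II.
Proof.
have -> : II = (fst @^-1` I) `&` (snd @^-1` I) by [].
by apply: closedI; apply: preimage_closed; try exact: interval_closed;
  move=> p _; [exact: cts1|exact: cts2].
Qed.

(* Only the values on [0, 1] matter: [loop_homotopic] ignores the others. *)
Record loop (T : topologicalType) (x : T) := Loop {
  loop_fun :> R -> T;
  loop_cts : {within I, continuous loop_fun};
  loop_0 : loop_fun 0 = x;
  loop_1 : loop_fun 1 = x }.

HB.instance Definition _ T x := gen_eqMixin (@loop T x).
HB.instance Definition _ T x := gen_choiceMixin (@loop T x).

Section Fixed.
Context {T : topologicalType} {x : T}.
Implicit Types f g h : loop x.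

Definition loop_homotopic f g := exists H : R * R -> T,
  [/\ {within II, continuous H},
      forall t, I t -> H (0, t) = f t,
      forall t, I t -> H (1, t) = g t &
      forall s, I s -> H (s, 0) = x /\ H (s, 1) = x].

Lemma I01 (t : R) : I t <-> 0 <= t <= 1.
Proof. by rewrite /= in_itv. Qed.

Lemma II01 (p : R * R) : II p <-> (0 <= p.1 <= 1 /\ 0 <= p.2 <= 1).
Proof. by rewrite /= !in_itv. Qed.

Lemma loop_reparam (F : R -> T) f g (a b : R -> R) :
  {within I, continuous F} ->
  continuous a -> continuous b ->
  (forall t, I t -> I (a t)) -> (forall t, I t -> I (b t)) ->
  a 0 = b 0 -> a 1 = b 1 ->
  (forall t, I t -> f t = F (a t)) -> (forall t, I t -> g t = F (b t)) ->
  loop_homotopic f g.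
Proof.
move=> cF ca cb Ia Ib ab0 ab1 fE gE.
have I0 : I 0 by apply/I01; rewrite lexx ler01.
have I1 : I 1 by apply/I01; rewrite lexx ler01.
exists (fun p => F ((1 - p.1) * a p.2 + p.1 * b p.2)); split.
- apply: (@within_comp _ _ _ _ I (fun p : R * R => (1 - p.1) * a p.2 + p.1 * b p.2) F) => //.
    apply: continuous_subspaceT => p.
    apply: (@continuousD R R^o _ (fun p : R * R => (1 - p.1) * a p.2)
      (fun p => p.1 * b p.2)).
      apply: (@continuousM R (R * R)%type (fun p => 1 - p.1) (fun p => a p.2)).
        by apply: continuousB; [exact: cst_continuous|exact: cvg_fst].
      by apply: (@continuous_comp _ _ _ snd a); [exact: cvg_snd|exact: ca].
    apply: (@continuousM R (R * R)%type (fun p => p.1) (fun p => b p.2)).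
      exact: cvg_fst.
    by apply: (@continuous_comp _ _ _ snd b); [exact: cvg_snd|exact: cb].
  move=> p /II01 [p1 p2]; apply/I01.
  have /I01 := Ia p.2 (proj2 (I01 _) p2).
  have /I01 := Ib p.2 (proj2 (I01 _) p2).
  move: (a p.2) (b p.2) => u v; move: p1 => /andP[? ?] /andP[? ?] /andP[? ?].
  by apply/andP; split; nra.
- by move=> t It /=; rewrite subr0 mul1r mul0r addr0 fE.
- by move=> t It /=; rewrite subrr mul1r mul0r add0r gE.
- move=> s Is; rewrite -ab0 -ab1 -!mulrDl subrK !mul1r -!fE //.
  by rewrite loop_0 loop_1.
Qed.

Lemma loop_homotopic_ext f g : (forall t, I t -> f t = g t) ->
  loop_homotopic f g.
Proof.
move=> fg; apply: (@loop_reparam f _ _ id id) => //.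
- exact: loop_cts.
- by move=> t; exact: cvg_id.
- by move=> t; exact: cvg_id.
- by move=> t It; rewrite fg.
Qed.

Lemma loop_homotopic_sym f g : loop_homotopic f g -> loop_homotopic g f.
Proof.
move=> [H [cH H0 H1 Hx]]; exists (fun p => H (1 - p.1, p.2)); split.
- apply: (@within_comp _ _ _ _ II (fun p : R * R => (1 - p.1, p.2)) H) => //.
    by apply: continuous_subspaceT; cts_tac.
  by move=> p /II01 [p1 p2]; apply/II01; split=> /=; lra.
- by move=> t It; rewrite /= subr0 H1.
- by move=> t It; rewrite /= subrr H0.
- by move=> s /I01 Is /=; apply: Hx; apply/I01; lra.
Qed.

Lemma loop_homotopic_trans g f h :
  loop_homotopic f g -> loop_homotopic g h -> loop_homotopic f h.
Proof.
move=> [H [cH H0 H1 Hx]] [K [cK K0 K1 Kx]].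
exists (fun p => if p.1 <= 2^-1 then H (2 * p.1, p.2) else K (2 * p.1 - 1, p.2)).
split.
- apply: (@within_paste _ _ (II `&` [set p | p.1 <= 2^-1])
    (II `&` [set p | 2^-1 <= p.1]) _
    (fun p => H (2 * p.1, p.2)) (fun p => K (2 * p.1 - 1, p.2))).
  + apply: closedI; first exact: closed_II.
    by apply: closed_le; [exact: cts1|exact: ctsC].
  + apply: closedI; first exact: closed_II.
    by apply: closed_le; [exact: ctsC|exact: cts1].
  + move=> p IIp; have [/ltW|?] := ltP p.1 2^-1; [by left|by right].
  + by move=> p [_ /= ->].
  + move=> p [/II01 [p1 p2] /= hp]; case: ifPn => // hp'.
    have -> : p.1 = 2^-1 by apply/eqP; rewrite eq_le hp hp'.
    by rewrite mulfV// subrr K0 ?H1 //; apply/I01.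
  + apply: (@within_comp _ _ _ _ II (fun p : R * R => (2 * p.1, p.2)) H) => //.
      by apply: continuous_subspaceT; cts_tac.
    by move=> p [/II01 [p1 p2] hp]; apply/II01; move: hp => /= hp; split=> /=; lra.
  + apply: (@within_comp _ _ _ _ II (fun p : R * R => (2 * p.1 - 1, p.2)) K) => //.
      by apply: continuous_subspaceT; cts_tac.
    by move=> p [/II01 [p1 p2] hp]; apply/II01; move: hp => /= hp; split=> /=; lra.
- by move=> t It /=; rewrite invr_ge0 ler0n mulr0 H0.
- move=> t It /=; rewrite ifF; last by apply/negbTE; rewrite -ltNge; lra.
  by rewrite mulr1 -K1 //; congr (K (_, _)); ring.
- move=> s /I01 Is /=; case: ifPn => hs.
    by apply: Hx; apply/I01; lra.
  by apply: Kx; apply/I01; rewrite -ltNge in hs; lra.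
Qed.

Definition loop_cat_fun f g (t : R) : T :=
  if t <= 2^-1 then f (2 * t) else g (2 * t - 1).

Lemma loop_cat_cts f g : {within I, continuous (loop_cat_fun f g)}.
Proof.
apply: (@within_paste _ _ (I `&` [set p | p <= 2^-1])
    (I `&` [set p | 2^-1 <= p]) _
    (fun p => f (2 * p)) (fun p => g (2 * p - 1))).
+ apply: closedI; first exact: interval_closed.
  by apply: closed_le; [exact: ctsI|exact: ctsC].
+ apply: closedI; first exact: interval_closed.
  by apply: closed_le; [exact: ctsC|exact: ctsI].
+ move=> p Ip; have [/ltW|?] := ltP p 2^-1; [by left|by right].
+ by move=> p [_ /= hp]; rewrite /loop_cat_fun hp.
+ move=> p [_ /= hp]; rewrite /loop_cat_fun; case: ifPn => // hp'.
  have -> : p = 2^-1 by apply/eqP; rewrite eq_le hp hp'.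
  by rewrite mulfV// subrr loop_0 loop_1.
+ apply: (@within_comp _ _ _ _ I (fun p : R => 2 * p) f).
  * by apply: continuous_subspaceT; cts_tac.
  * by move=> p [/I01 p1 hp]; apply/I01; move: hp => /= hp; lra.
  * exact: loop_cts.
+ apply: (@within_comp _ _ _ _ I (fun p : R => 2 * p - 1) g).
  * by apply: continuous_subspaceT; cts_tac.
  * by move=> p [/I01 p1 hp]; apply/I01; move: hp => /= hp; lra.
  * exact: loop_cts.
Qed.

Lemma loop_cat_0 f g : loop_cat_fun f g 0 = x.
Proof. by rewrite /loop_cat_fun invr_ge0 ler0n mulr0 loop_0. Qed.

Lemma loop_cat_1 f g : loop_cat_fun f g 1 = x.
Proof.
rewrite /loop_cat_fun ifF; last by apply/negbTE; rewrite -ltNge; lra.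
by rewrite -[RHS](loop_1 g) //; congr (g _); ring.
Qed.

Definition loop_cat f g : loop x :=
  Loop (@loop_cat_cts f g) (loop_cat_0 f g) (loop_cat_1 f g).

Lemma loop_cst_cts : {within I, continuous (fun _ : R => x)}.
Proof. by apply: continuous_subspaceT => t; exact: cvg_cst. Qed.

Definition loop_cst : loop x := Loop loop_cst_cts erefl erefl.

Lemma loop_rev_cts f : {within I, continuous (fun t => f (1 - t))}.
Proof.
apply: (@within_comp _ _ _ _ I (fun p : R => 1 - p) f).
- by apply: continuous_subspaceT; cts_tac.
- by move=> p /I01 p1; apply/I01; lra.
- exact: loop_cts.
Qed.

Lemma loop_rev_0 f : f (1 - 0) = x. Proof. by rewrite subr0 loop_1. Qed.
Lemma loop_rev_1 f : f (1 - 1) = x. Proof. by rewrite subrr loop_0. Qed.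

Definition loop_rev f : loop x :=
  Loop (@loop_rev_cts f) (loop_rev_0 f) (loop_rev_1 f).

Lemma loop_cat_homotopic f f' g g' :
  loop_homotopic f f' -> loop_homotopic g g' ->
  loop_homotopic (loop_cat f g) (loop_cat f' g').
Proof.
move=> [H [cH H0 H1 Hx]] [K [cK K0 K1 Kx]].
exists (fun p => if p.2 <= 2^-1 then H (p.1, 2 * p.2) else K (p.1, 2 * p.2 - 1)).
split.
- apply: (@within_paste _ _ (II `&` [set p | p.2 <= 2^-1])
    (II `&` [set p | 2^-1 <= p.2]) _
    (fun p => H (p.1, 2 * p.2)) (fun p => K (p.1, 2 * p.2 - 1))).
  + apply: closedI; first exact: closed_II.
    by apply: closed_le; [exact: cts2|exact: ctsC].
  + apply: closedI; first exact: closed_II.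
    by apply: closed_le; [exact: ctsC|exact: cts2].
  + move=> p IIp; have [/ltW|?] := ltP p.2 2^-1; [by left|by right].
  + by move=> p [_ /= ->].
  + move=> p [/II01 [p1 p2] /= hp]; case: ifPn => // hp'.
    have -> : p.2 = 2^-1 by apply/eqP; rewrite eq_le hp hp'.
    rewrite mulfV// subrr (proj1 (Kx _ _)) ?(proj2 (Hx _ _)) //; exact/I01.
  + apply: (@within_comp _ _ _ _ II (fun p : R * R => (p.1, 2 * p.2)) H) => //.
      by apply: continuous_subspaceT; cts_tac.
    by move=> p [/II01 [p1 p2] hp]; apply/II01; move: hp => /= hp; split=> /=; lra.
  + apply: (@within_comp _ _ _ _ II (fun p : R * R => (p.1, 2 * p.2 - 1)) K) => //.
      by apply: continuous_subspaceT; cts_tac.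
    by move=> p [/II01 [p1 p2] hp]; apply/II01; move: hp => /= hp; split=> /=; lra.
- move=> t /I01 It /=; rewrite /loop_cat_fun; case: ifPn => ht.
    by apply: H0; apply/I01; lra.
  by apply: K0; apply/I01; rewrite -ltNge in ht; lra.
- move=> t /I01 It /=; rewrite /loop_cat_fun; case: ifPn => ht.
    by apply: H1; apply/I01; lra.
  by apply: K1; apply/I01; rewrite -ltNge in ht; lra.
- move=> s Is /=; rewrite invr_ge0 ler0n mulr0 (proj1 (Hx _ _))//; split=> //.
  rewrite ifF; last by apply/negbTE; rewrite -ltNge; lra.
  by rewrite -[RHS](proj2 (Kx s Is)) mulr1; congr (K (_, _)); ring.
Qed.

Lemma loop_rev_homotopic f g :
  loop_homotopic f g -> loop_homotopic (loop_rev f) (loop_rev g).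
Proof.
move=> [H [cH H0 H1 Hx]]; exists (fun p => H (p.1, 1 - p.2)); split.
- apply: (@within_comp _ _ _ _ II (fun p : R * R => (p.1, 1 - p.2)) H) => //.
    by apply: continuous_subspaceT; cts_tac.
  by move=> p /II01 [p1 p2]; apply/II01; split=> /=; lra.
- by move=> t /I01 It /=; apply: H0; apply/I01; lra.
- by move=> t /I01 It /=; apply: H1; apply/I01; lra.
- by move=> s /Hx [? ?] /=; rewrite subr0 subrr.
Qed.

Lemma cts_min (a b : R -> R) : continuous a -> continuous b ->
  continuous (fun t => Num.min (a t) (b t)).
Proof. by move=> ca cb t; apply: continuous_min; [exact: ca|exact: cb]. Qed.

Lemma cts_max (a b : R -> R) : continuous a -> continuous b ->
  continuous (fun t => Num.max (a t) (b t)).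
Proof. by move=> ca cb t; apply: continuous_max; [exact: ca|exact: cb]. Qed.

Lemma cts_affine (a b : R) : continuous (fun t => a * t + b).
Proof.
by move=> t; apply: cvgD; [apply: ctsM; [exact: ctsC|exact: ctsI]|exact: cvg_cst].
Qed.

Lemma loop_catA f g h :
  loop_homotopic (loop_cat f (loop_cat g h)) (loop_cat (loop_cat f g) h).
Proof.
apply: loop_homotopic_sym.
apply: (@loop_reparam (loop_cat f (loop_cat g h)) _ _
  (fun t => Num.min (Num.min (2 * t + 0) (1 * t + 4^-1)) (2^-1 * t + 2^-1)) id).
- exact: loop_cts.
- by do 2 ?apply: cts_min; exact: cts_affine.
- by move=> t; exact: cvg_id.
- by move=> t /I01 It; apply/I01; rewrite !minEle; do !case: ifPn; rewrite -?ltNge; lra.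
- by [].
- by rewrite !minEle; do !case: ifPn; rewrite -?ltNge; lra.
- by rewrite !minEle; do !case: ifPn; rewrite -?ltNge; lra.
- move=> t /I01 It /=; rewrite /loop_cat_fun /= /loop_cat_fun !minEle.
  have E u v (k : loop x) : u = v -> k u = k v by move->.
  by do ![case: ifPn]; rewrite -?ltNge => *; first [exfalso; lra|apply: E; lra].
- by [].
Qed.

Lemma loop_cat1 f : loop_homotopic (loop_cat f loop_cst) f.
Proof.
apply: (@loop_reparam f _ _ (fun t => Num.min (2 * t + 0) (0 * t + 1)) id).
- exact: loop_cts.
- by apply: cts_min; exact: cts_affine.
- by move=> t; exact: cvg_id.
- by move=> t /I01 It; apply/I01; rewrite !minEle; do !case: ifPn; rewrite -?ltNge; lra.
- by [].
- by rewrite !minEle; do !case: ifPn; rewrite -?ltNge; lra.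
- by rewrite !minEle; do !case: ifPn; rewrite -?ltNge; lra.
- move=> t /I01 It /=; rewrite /loop_cat_fun /= !minEle.
  have E u v (k : loop x) : u = v -> k u = k v by move->.
  do ![case: ifPn]; rewrite -?ltNge => *;
    by first [exfalso; lra|apply: E; lra|rewrite -[LHS](loop_1 f); apply: E; lra].
- by [].
Qed.

Lemma loop_1cat f : loop_homotopic (loop_cat loop_cst f) f.
Proof.
apply: (@loop_reparam f _ _ (fun t => Num.max (2 * t + - 1) (0 * t + 0)) id).
- exact: loop_cts.
- by apply: cts_max; exact: cts_affine.
- by move=> t; exact: cvg_id.
- by move=> t /I01 It; apply/I01; rewrite !maxEle; do !case: ifPn; rewrite -?ltNge; lra.
- by [].
- by rewrite !maxEle; do !case: ifPn; rewrite -?ltNge; lra.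
- by rewrite !maxEle; do !case: ifPn; rewrite -?ltNge; lra.
- move=> t /I01 It /=; rewrite /loop_cat_fun /= !maxEle.
  have E u v (k : loop x) : u = v -> k u = k v by move->.
  do ![case: ifPn]; rewrite -?ltNge => *;
    by first [exfalso; lra|apply: E; lra|rewrite -[LHS](loop_0 f); apply: E; lra].
- by [].
Qed.

Lemma loop_catV f : loop_homotopic (loop_cat f (loop_rev f)) loop_cst.
Proof.
apply: (@loop_reparam f _ _ (fun t => Num.min (2 * t + 0) (- 2 * t + 2))
  (fun=> 0)).
- exact: loop_cts.
- by apply: cts_min; exact: cts_affine.
- by move=> t; exact: cvg_cst.
- by move=> t /I01 It; apply/I01; rewrite !minEle; do !case: ifPn; rewrite -?ltNge; lra.
- by move=> t /I01 It; apply/I01; lra.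
- by rewrite !minEle; do !case: ifPn; rewrite -?ltNge; lra.
- by rewrite !minEle; do !case: ifPn; rewrite -?ltNge; lra.
- move=> t /I01 It /=; rewrite /loop_cat_fun /= !minEle.
  have E u v (k : loop x) : u = v -> k u = k v by move->.
  by do ![case: ifPn]; rewrite -?ltNge => *; first [exfalso; lra|apply: E; lra].
- by move=> t _; rewrite loop_0.
Qed.

Lemma loop_Vcat f : loop_homotopic (loop_cat (loop_rev f) f) loop_cst.
Proof.
apply: (@loop_reparam f _ _ (fun t => Num.max (2 * t - 1) (- 2 * t + 1))
  (fun=> 1)).
- exact: loop_cts.
- by apply: cts_max; exact: cts_affine.
- by move=> t; exact: cvg_cst.
- by move=> t /I01 It; apply/I01; rewrite !maxEle; do !case: ifPn; rewrite -?ltNge; lra.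
- by move=> t /I01 It; apply/I01; lra.
- by rewrite !maxEle; do !case: ifPn; rewrite -?ltNge; lra.
- by rewrite !maxEle; do !case: ifPn; rewrite -?ltNge; lra.
- move=> t /I01 It /=; rewrite /loop_cat_fun /= !maxEle.
  have E u v (k : loop x) : u = v -> k u = k v by move->.
  by do ![case: ifPn]; rewrite -?ltNge => *; first [exfalso; lra|apply: E; lra].
- by move=> t _; rewrite loop_1.
Qed.

Definition loop_equiv f g : bool := `[< loop_homotopic f g >].

Lemma loop_equiv_equiv : equiv_class_of loop_equiv.
Proof.
split=> [f|f g|g f h].
- by apply/asboolP/loop_homotopic_ext.
- by apply/asboolP/asboolP; exact: loop_homotopic_sym.
- by move=> /asboolP fg /asboolP gh; apply/asboolP; exact: loop_homotopic_trans gh.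
Qed.

Canonical loop_equiv_equivRel := EquivRelPack loop_equiv_equiv.
Canonical loop_equiv_encModRel := defaultEncModRel loop_equiv.

End Fixed.

Definition pi1 (T : topologicalType) (x : T) : Type :=
  {eq_quot (@loop_equiv T x)}.

HB.instance Definition _ T x := Choice.on (@pi1 T x).

Definition pi1_class (T : topologicalType) (x : T) (f : loop x) : pi1 x :=
  \pi_({eq_quot (@loop_equiv T x)}) f.

Section Group.
Context {T : topologicalType} {x : T}.

Lemma pi1_classP (f g : loop x) :
  pi1_class f = pi1_class g <-> loop_homotopic f g.
Proof. by split=> [/eqmodP/asboolP//|fg]; apply/eqmodP/asboolP. Qed.

Definition pi1_repr (a : pi1 x) : loop x :=
  repr (a : {eq_quot (@loop_equiv T x)}).

Lemma pi1_reprK a : pi1_class (pi1_repr a) = a.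
Proof. exact: reprK. Qed.

Definition pi1_mul (a b : pi1 x) : pi1 x :=
  pi1_class (loop_cat (pi1_repr a) (pi1_repr b)).
Definition pi1_inv (a : pi1 x) : pi1 x := pi1_class (loop_rev (pi1_repr a)).

Lemma pi1_mulE f g :
  pi1_mul (pi1_class f) (pi1_class g) = pi1_class (loop_cat f g).
Proof.
by apply/pi1_classP/loop_cat_homotopic; apply/pi1_classP; rewrite pi1_reprK.
Qed.

Lemma pi1_invE f : pi1_inv (pi1_class f) = pi1_class (loop_rev f).
Proof.
by apply/pi1_classP/loop_rev_homotopic; apply/pi1_classP; rewrite pi1_reprK.
Qed.

Lemma pi1_mulA : associative pi1_mul.
Proof.
move=> a b c; rewrite -(pi1_reprK a) -(pi1_reprK b) -(pi1_reprK c) !pi1_mulE.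
exact/pi1_classP/loop_catA.
Qed.
Lemma pi1_mul1g : left_id (pi1_class (loop_cst (x := x))) pi1_mul.
Proof.
by move=> a; rewrite -(pi1_reprK a) pi1_mulE; exact/pi1_classP/loop_1cat.
Qed.
Lemma pi1_mulg1 : right_id (pi1_class (loop_cst (x := x))) pi1_mul.
Proof.
by move=> a; rewrite -(pi1_reprK a) pi1_mulE; exact/pi1_classP/loop_cat1.
Qed.
Lemma pi1_mulVg : left_inverse (pi1_class (loop_cst (x := x))) pi1_inv pi1_mul.
Proof.
by move=> a; rewrite -(pi1_reprK a) pi1_invE pi1_mulE; exact/pi1_classP/loop_Vcat.
Qed.
Lemma pi1_mulgV : right_inverse (pi1_class (loop_cst (x := x))) pi1_inv pi1_mul.
Proof.
by move=> a; rewrite -(pi1_reprK a) pi1_invE pi1_mulE; exact/pi1_classP/loop_catV.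
Qed.

End Group.

HB.instance Definition _ (T : topologicalType) (x : T) :=
  isGroup.Build (pi1 x) (@pi1_mulA T x) (@pi1_mul1g T x) (@pi1_mulg1 T x)
    (@pi1_mulVg T x) (@pi1_mulgV T x).

End Pi1.

Arguments loop R {T} x.
Arguments pi1 R {T} x.

Section Pi1Map.
Context {R : realType} {T U : topologicalType} (f : T -> U) (cf : continuous f).
Context {x : T}.

Lemma loop_map_cts (l : loop R x) :
  {within `[0%R, 1%R]%classic, continuous (f \o l)}.
Proof.
apply: (@within_comp _ _ _ _ setT) => //; first exact: loop_cts.
exact: continuous_subspaceT.
Qed.

Lemma loop_map_0 (l : loop R x) : (f \o l) 0 = f x.
Proof. by rewrite /= loop_0. Qed.
Lemma loop_map_1 (l : loop R x) : (f \o l) 1 = f x.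
Proof. by rewrite /= loop_1. Qed.

Definition loop_map (l : loop R x) : loop R (f x) :=
  Loop (@loop_map_cts l) (loop_map_0 l) (loop_map_1 l).

Definition pi1_map (a : pi1 R x) : pi1 R (f x) :=
  pi1_class (loop_map (pi1_repr a)).

Lemma loop_map_homotopic (l l' : loop R x) :
  loop_homotopic l l' -> loop_homotopic (loop_map l) (loop_map l').
Proof.
move=> [H [cH H0 H1 Hx]]; exists (f \o H); split.
- apply: (@within_comp _ _ _ _ setT) => //; exact: continuous_subspaceT.
- by move=> t It /=; rewrite H0.
- by move=> t It /=; rewrite H1.
- by move=> s Is /=; case: (Hx s Is) => -> ->.
Qed.

Lemma pi1_mapE (l : loop R x) : pi1_map (pi1_class l) = pi1_class (loop_map l).
Proof. by apply/pi1_classP/loop_map_homotopic/pi1_classP; rewrite pi1_reprK. Qed.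

Lemma pi1_mapM (a b : pi1 R x) : pi1_map (a * b)%g = (pi1_map a * pi1_map b)%g.
Proof.
rewrite -[LHS]/(pi1_map (pi1_mul a b)) -[RHS]/(pi1_mul (pi1_map a) (pi1_map b)).
rewrite -(pi1_reprK a) -(pi1_reprK b) pi1_mulE !pi1_mapE pi1_mulE; apply/pi1_classP/loop_homotopic_ext => t _ /=.
by rewrite /loop_cat_fun; case: ifP.
Qed.

End Pi1Map.

Section Topology.
Context {T : topologicalType}.

Definition embedding {U : topologicalType} (f : T -> U) :=
  [/\ injective f, continuous f &
      forall A, open A -> exists2 B, open B & A = f @^-1` B].

Definition homeomorphism {U : topologicalType} (f : T -> U) :=
  continuous f /\
  exists g : U -> T, [/\ continuous g, cancel f g & cancel g f].

Definition frontier (A : set T) : set T := closure A `\` A°.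

Lemma closed_frontier_sub (A : set T) : closed A -> frontier A `<=` A.
Proof. by move=> cA x [/cA]. Qed.

Definition set_incl (A B : set T) (AB : A `<=` B) (a : A) : B :=
  SigSub (mem_set (AB _ (set_valP a))).

Lemma set_incl_cts (A B : set T) (AB : A `<=` B) : continuous (set_incl AB).
Proof.
apply: continuous_comp_initial => a; exact: initial_continuous.
Qed.

End Topology.

Section Knots.
Context {R : realType}.

Local Notation plane := (R * R)%type.
Local Notation space := (R * R * R)%type.
Local Notation S3 := (one_point_compactification space).

Definition circle : set plane := [set p | p.1 ^+ 2 + p.2 ^+ 2 = 1].
Definition disk : set plane := [set p | p.1 ^+ 2 + p.2 ^+ 2 <= 1].

Definition is_knot (K : set S3) :=
  exists2 f : circle -> S3, embedding f & range f = K.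

(* [h] may reverse orientation, which affects neither tameness nor triviality. *)
Definition knot_equiv (K K' : set S3) :=
  exists2 h : S3 -> S3, homeomorphism h & h @` K = K'.

Definition segment (a b : space) : set space :=
  [set (1 - t) *: a + t *: b | t in `[0%R, 1%R]].

Definition polygonal (K : set S3) := exists s : seq (space * space),
  K = Some @` \bigcup_(e in [set` s]) segment e.1 e.2.

Definition tame_knot (K : set S3) :=
  is_knot K /\ exists2 K', polygonal K' & knot_equiv K K'.

Definition unknot : set S3 :=
  Some @` [set p : space | circle p.1 /\ p.2 = 0].

Definition nontrivial_knot (K : set S3) := ~ knot_equiv K unknot.

(* [N] is the unit-disk part of an open solid torus S^1 x R^2 around [K], which
   makes its boundary torus bicollared, so that it cannot be wild. *)
Definition tubular_nbhd (K N : set S3) := exists h : circle * plane -> S3,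
  [/\ embedding h, open (range h), h @` [set p | p.2 = 0] = K &
      h @` [set p | disk p.2] = N].

Definition knot_exterior (N : set S3) : set S3 := ~` N°.

Definition exterior_boundary (N : set S3) : set S3 :=
  frontier (knot_exterior N).

Lemma exterior_boundary_sub N : exterior_boundary N `<=` knot_exterior N.
Proof. by apply: closed_frontier_sub; exact/open_closedC/open_interior. Qed.

Definition boundary_incl (N : set S3) :
    exterior_boundary N -> knot_exterior N :=
  set_incl (@exterior_boundary_sub N).

Lemma boundary_incl_cts N : continuous (@boundary_incl N).
Proof. exact: set_incl_cts. Qed.

Definition knot_group (N : set S3) (x0 : exterior_boundary N) : groupType :=
  pi1 R (boundary_incl x0).

Definition peripheral_map (N : set S3) (x0 : exterior_boundary N) :
    pi1 R x0 -> knot_group x0 :=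
  pi1_map (@boundary_incl_cts N).

(* Around their unique common point, [D] and [K] look like the xy-plane and the
   z-axis: without this, a disk tangent to [K] would also meet it once. *)
Definition meets_once_transversally (D K : set S3) :=
  exists phi : plane * R -> S3,
    [/\ embedding phi, open (range phi), D `&` K = [set phi (0, 0)],
        phi @^-1` D = [set p | p.2 = 0] & phi @^-1` K = [set p | p.1 = 0]].

Definition is_meridian (K N : set S3) (x0 : exterior_boundary N)
    (mu : pi1 R x0) :=
  exists (l : loop R x0) (d : disk -> S3),
    [/\ mu = pi1_class l,
        {in `[0%R, 1%R[ &, injective l},
        embedding d /\ range d `<=` N,
        d @` [set z | circle (\val z)] = [set \val (l t) | t in `[0%R, 1%R]] &
        meets_once_transversally (range d) K].

End Knots.

Section Groups.
Local Open Scope group_scope.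

Definition normal_subgroup (G : groupType) (N : set G) :=
  [/\ N 1, forall x y, N x -> N y -> N (x * y^-1) &
      forall g x, N x -> N (g * x * g^-1)].

Definition normal_closure (G : groupType) (S : set G) : set G :=
  \bigcap_(N in [set N | normal_subgroup N /\ S `<=` N]) N.

Definition cyclic_subgroup (G : groupType) (x : G) : set G :=
  [set y | exists n : nat, y = x ^+ n \/ y = x ^- n].

Definition finite_index (G : groupType) (U : set G) :=
  finite_set (range (fun g : G => [set g * u | u in U])).

Section Ramification.
Context {G : groupType} {S : pred G} (U : subGroupType S) (m : G).

Definition inertia (g : G) : set U :=
  [set u | [set g * x * g^-1 | x in cyclic_subgroup m] (\val u)].

Definition ramification : set U := normal_closure (\bigcup_g inertia g).

End Ramification.
End Groups.

Arguments inertia {G S} U m g.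
Arguments ramification {G S} U m.

(* Main.v *)
Require Import Defs.
From HB Require Import structures.
From mathcomp Require Import all_boot all_order all_fingroup all_algebra.
From mathcomp Require Import all_classical all_reals all_analysis.
Set Implicit Arguments.
Unset Strict Implicit.
Unset Printing Implicit Defensive.
Import numFieldNormedType.Exports.
Local Open Scope classical_set_scope.
Local Open Scope group_scope.

(** Along a surjective homomorphism, images and preimages of normal subgroups
    are normal, so taking the image commutes with taking the normal closure
    ([image_normal_closure]). Applied to q and the union of the inertia
    subgroups, this is the displayed formula for q(M_U). The description of
    F/q(M_U) as a largest quotient restates the universal property of the
    normal closure: a subset of F containing 1 has trivial image in F/P exactly
    when it lies in P ([coset_image_trivial]), and q(M_U) is the least normal
    subgroup of F containing all the q(I_g(U)). *)

Section NormalClosure.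
Context {G : groupType}.
Implicit Types (A N : set G).

Lemma normal_closure_normal A : normal_subgroup (normal_closure A).
Proof.
split=> [N [[]]//|x y Ax Ay N NA|g x Ax N NA]; case: (NA) => -[_ NB NJ] _.
- by apply: NB; [exact: Ax|exact: Ay].
- by apply: NJ; exact: Ax.
Qed.

Lemma sub_normal_closure A : A `<=` normal_closure A.
Proof. by move=> x Ax N [_]; apply. Qed.

Lemma normal_closure_min A N :
  normal_subgroup N -> A `<=` N -> normal_closure A `<=` N.
Proof. by move=> nN AN x; apply. Qed.

End NormalClosure.

Section Homomorphism.
Context {G H : groupType} (f : {multiplicative G -> H}).

Lemma multiplicative1 : f 1 = 1.
Proof. by apply: (mulgI (f 1)); rewrite -gmulfM !mulg1. Qed.

Lemma multiplicativeV : {morph f : x / x^-1}.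
Proof.
by move=> x; apply: (mulgI (f x)); rewrite -gmulfM !mulgV multiplicative1.
Qed.

Lemma preimage_normal_subgroup (N : set H) :
  normal_subgroup N -> normal_subgroup (f @^-1` N).
Proof.
move=> [N1 NB NJ]; split=> [|x y Nx Ny|g x Nx] /=.
- by rewrite multiplicative1.
- by rewrite gmulfM multiplicativeV; exact: NB.
- by rewrite !gmulfM multiplicativeV; exact: NJ.
Qed.

Lemma image_normal_subgroup (N : set G) : set_surj [set: G] [set: H] f ->
  normal_subgroup N -> normal_subgroup (f @` N).
Proof.
move=> f_surj [N1 NB NJ]; split=> [|_ _ [x Nx <-] [y Ny <-]|h _ [x Nx <-]].
- by exists 1; rewrite ?multiplicative1.
- by exists (x * y^-1); [exact: NB|rewrite gmulfM multiplicativeV].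
- have [g _ <-] := f_surj h I.
  by exists (g * x * g^-1); [exact: NJ|rewrite !gmulfM multiplicativeV].
Qed.

(** Each inclusion is minimality of a normal closure: the image on the left is a
    normal subgroup containing the image of A, and the preimage of the closure
    on the right is a normal subgroup containing A. *)
Lemma image_normal_closure (A : set G) : set_surj [set: G] [set: H] f ->
  f @` normal_closure A = normal_closure (f @` A).
Proof.
move=> f_surj; apply/seteqP; split.
- rewrite image_sub; apply: normal_closure_min.
    by apply: preimage_normal_subgroup; exact: normal_closure_normal.
  by rewrite -image_sub; exact: sub_normal_closure.
- apply: normal_closure_min.
    by apply: image_normal_subgroup => //; exact: normal_closure_normal.
  by apply: image_subset; exact: sub_normal_closure.
Qed.

End Homomorphism.

Section FiniteGroup.
Context {F : finGroupType}.

Lemma normal_subgroup_group (N : set F) : normal_subgroup N ->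
  exists2 Q : {group F}, [set` Q] = N & normal Q [set: F]%G.
Proof.
move=> [N1 NB NJ]; pose Q0 := finset (fun x => `[< N x >]).
have inQ x : (x \in Q0) = `[< N x >] by rewrite inE.
have gQ : group_set Q0.
  apply/group_setP; split=> [|x y]; rewrite !inQ; first exact/asboolP.
  move=> /asboolP Nx /asboolP Ny; apply/asboolP; rewrite -[y]invgK.
  by apply: (NB) => //; rewrite -[y^-1]mul1g; exact: NB.
exists (Group gQ); first by apply/seteqP; split=> x /=; rewrite inQ => /asboolP.
rewrite /normal finset.subsetT /=; apply/fintype.subsetP => g _; rewrite inE.
apply/fintype.subsetP => _ /imsetP[x + ->]; rewrite !inQ => /asboolP Nx.
apply/asboolP.
by have := NJ g^-1 _ Nx; rewrite invgK conjgE mulgA.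
Qed.

Lemma group_normal_subgroup (Q : {group F}) :
  normal Q [set: F]%G -> normal_subgroup [set` Q].
Proof.
move=> /normal_norm nQ; split=> [|x y Qx Qy|g x Qx] /=.
- exact: group1.
- by rewrite groupM ?groupV.
- have -> : g * x * g^-1 = x ^ g^-1 by rewrite conjgE invgK mulgA.
  rewrite memJ_norm// groupV.
  by apply: (fintype.subsetP nQ); rewrite inE.
Qed.

(** Normality matters because [coset P] sends every element outside the
    normaliser of P to 1. The element 1 of A makes the image nonempty. *)
Lemma coset_image_trivial (P : {group F}) (A : set F) :
  normal P [set: F]%G -> A 1 -> coset P @` A = [set 1] <-> A `<=` [set` P].
Proof.
move=> /normal_norm nP A1; split=> [AP x Ax|AP].
- apply: coset_idr; first by apply: (fintype.subsetP nP); rewrite inE.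
  by have : (coset P @` A) (coset P x) by [exists x]; rewrite AP.
- apply/seteqP; split=> [_ [x Ax <-]|_ ->] /=; first exact/coset_id/AP.
  by exists 1 => //; exact: morph1.
Qed.

End FiniteGroup.

Lemma inertia1 (G : groupType) (S : pred G) (U : subGroupType S) (m g : G) :
  inertia U m g 1.
Proof.
exists 1; first by exists 0%N; left; rewrite expg0.
by rewrite mulg1 mulgV gmulf1.
Qed.

Theorem corollary3p2 (R : realType)
  (K N : set (one_point_compactification (R * R * R)%type))
  (tameK : tame_knot K) (nontrivK : nontrivial_knot K)
  (tubN : tubular_nbhd K N)
  (x0 : exterior_boundary N) (mu : pi1 R x0) (mer_mu : is_meridian K mu)
  (S : pred (knot_group x0)) (U : subGroupType S)
  (finU : finite_index [set` S])
  (F : finGroupType) (q : {multiplicative U -> F})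
  (q_surj : set_surj [set: U] [set: F] q) :
  let m := peripheral_map mu in
  let M_U := ramification U m in
  exists Q : {group F},
    [/\ [set` Q] = q @` M_U,
        normal Q [set: F]%G,
        q @` M_U = normal_closure (\bigcup_g (q @` inertia U m g)),
        forall g, coset Q @` (q @` inertia U m g) = [set 1] &
        forall P : {group F}, normal P [set: F]%G ->
          (forall g, coset P @` (q @` inertia U m g) = [set 1]) ->
          Q \subset P].
Proof.
move=> m M_U.
have qM : q @` M_U = normal_closure (\bigcup_g (q @` inertia U m g)).
  by rewrite -image_bigcup; exact: image_normal_closure.
have [Q QM nQ] : exists2 Q : {group F}, [set` Q] = q @` M_U &
    normal Q [set: F]%G.
  by apply: normal_subgroup_group; rewrite qM; exact: normal_closure_normal.
have qI1 g : (q @` inertia U m g) 1.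
  by exists 1; [exact: inertia1|exact: multiplicative1].
exists Q; split=> //.
- move=> g; apply/(coset_image_trivial nQ (qI1 g)); rewrite QM qM => x Ix.
  by apply: sub_normal_closure; exists g.
- move=> P nP PI; apply/fintype.subsetP => x Qx.
  have : [set` Q] x by [].
  rewrite QM qM; apply: (@normal_closure_min _ _ [set` P]).
    exact: group_normal_subgroup.
  by move=> y [g _ Iy]; exact: (coset_image_trivial nP (qI1 g)).1 (PI g) _ Iy.
Qed.
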